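(* Let $p$ be an odd prime. For $0<k<p$ let $g_k(\alpha)\in\mathbb F_p(\alpha)$ be as defined in the context, and for an integer $d$ put $\pounds_d^{(\alpha)}(X)=\sum_{k=1}^{p-1}g_k(\alpha)X^k/k^d\in\mathbb F_p(\alpha)[X]$. Let $T(X)=\prod_{i=1}^{p-1}(1+X/i)^i$. Then for any $0<d<p-1$, \[ \frac{\pounds_1^{(\alpha)}(X)^d}{d}\equiv(-1)^{d-1}\sum_{r=0}^{d-1}{d\brack r+1}\alpha^r\,\pounds_{d-r}^{(\alpha)}(X)\pmod{X^p-T(\alpha)} \] in $\mathbb F_p(\alpha)[X]$.
   Context: For integers $0<k<p$ and $0<a<p$, $e(k,a)$ is the exponent of the highest power of $p$ dividing $\prod_{s=1}^{k}\binom{sa}{a}$, and $g_k(\alpha)=\prod_{0<a<p}(1+\alpha/a)^{-e(k,a)}$ viewed in $\mathbb F_p(\alpha)$. ${n\brack k}$ denotes the unsigned Stirling number of the first kind, characterized for $0<k\le n$ by $(X+n-1)(X+n-2)\cdots X=\sum_{k=1}^n{n\brack k}X^k$ in $\mathbb Z[X]$ (reduced mod $p$). *)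

(* Defs.v *)
From mathcomp Require Import all_boot all_order all_algebra.

Set Implicit Arguments.
Unset Strict Implicit.
Unset Printing Implicit Defensive.

Import GRing.Theory.
Local Open Scope ring_scope.

(* The field F_p(alpha) of rational functions; 'F_p is Z/pZ for p prime. *)
Definition Fpa (p : nat) : fieldType := {fraction {poly 'F_p}}.

Definition alpha (p : nat) : Fpa p := tofrac ('X : {poly 'F_p}).

Definition e_exp (p k a : nat) : nat :=
  logn p (\prod_(1 <= s < k.+1) 'C(s * a, a))%N.

Definition g (p k : nat) : Fpa p :=
  \prod_(1 <= a < p) (1 + alpha p / a%:R) ^- e_exp p k a.

Definition pounds (p : nat) (d : int) : {poly Fpa p} :=
  \sum_(1 <= k < p) (g p k / (k%:R : Fpa p) ^ d) *: 'X^k.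

(* The coefficients of T lie in the prime field; it is taken over an arbitrary
   field F so that it can be evaluated at an element of F. *)
Definition T (F : fieldType) (p : nat) : {poly F} :=
  \prod_(1 <= i < p) (1 + (i%:R : F)^-1 *: 'X) ^+ i.

Definition stirling1 (n k : nat) : int :=
  (\prod_(i < n) ('X + i%:R : {poly int}))`_k.

(* Main.v *)
Require Import Defs.
From mathcomp Require Import all_boot all_order all_algebra all_field.
From mathcomp Require Import ring zify.

Set Implicit Arguments.
Unset Strict Implicit.
Unset Printing Implicit Defensive.
Import GRing.Theory.
Local Open Scope ring_scope.

(** Let [S_e] be the sum over nonzero [k] in F_p of [k^-e T(k X)] in F_p[X].
    Composing the Frobenius of F_p(alpha) with evaluation at [T(alpha)] defines
    a map [F_p(alpha)[Y] -> F_p(alpha)] that kills [Y^p - T(alpha)].  As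
    [e(k,a) = floor(k a / p)], it sends [g_k Y^k] to the product of the
    [(1 + alpha/a)^(k a mod p)], that is to [T(k alpha)], and the polylogarithm
    of index [e] to [S_e(alpha)].  From [(X^(p-1) - 1) T' = T] the powers
    [T^0, ..., T^(p-1)] are eigenvectors of the derivation
    [D = (X^(p-1) - 1) d/dX] with distinct eigenvalues, hence independent over
    the p-th powers, and the map is injective on polynomials of degree less
    than p.

    It remains to prove the image identity in F_p[X].  The differential equation
    and [deg T = p(p-1)/2] force the coefficient of [X^(p m + r)] in [T] to
    vanish when [2m + r >= p].  Hence, for [0 < e < p - 1], [S_e] only involves
    the monomials [(X^p)^m X^(e-m)] with [m <= e]; in particular
    [S_1 = X - X^p].  Since [D S_(e+1) = S_e], the Stirling recurrence shows by
    induction on [d] that both sides have the same derivative; their difference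
    is then a multiple of [X^(p d)], and it vanishes at [-1]. *)

(** * Stirling numbers, the degree of [T], and the exponents [e(k,a)] *)

Lemma stirling1_0 n : (0 < n)%N -> stirling1 n 0 = 0.
Proof.
case: n => // n _; rewrite /stirling1 big_ord_recl.
by rewrite addr0 coefXM.
Qed.

Lemma stirling1_large n k : (n < k)%N -> stirling1 n k = 0.
Proof.
move=> nk; apply: nth_default; rewrite -(prednK (leq_ltn_trans (leq0n n) nk)).
rewrite (leq_trans (size_poly_prod_leq _ _)) // leq_subLR.
apply: (@leq_trans (\sum_(i < n) 2).+1); last first.
  by rewrite sum_nat_const card_ord; lia.
rewrite ltnS; apply: leq_sum => i _.
by rewrite -polyC_natr -[_%:P]opprK -polyCN size_XsubC.
Qed.

Lemma stirling1S n k :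
  stirling1 n.+1 k.+1 = stirling1 n k + n%:R * stirling1 n k.+1.
Proof.
rewrite /stirling1 big_ord_recr /= mulrDr coefD coefMX /=; congr (_ + _).
by rewrite -polyC_natr coefMC mulrC.
Qed.

(** The degree is at most 1 + 2 + ... + (n - 1); doubling avoids a division. *)
Lemma size_T (F : fieldType) (n : nat) : ((size (T F n)).-1.*2 <= n * n.-1)%N.
Proof.
rewrite /T; elim: n => [|[|n] IH]; try by rewrite ?big_geq ?size_poly1.
rewrite big_nat_recr //=; move: IH.
set P := \prod_(1 <= i < n.+1) _; set L := 1 + _.
have := size_polyMleq P (L ^+ n.+1).
have := size_poly_exp_leq L n.+1.
have : (size L <= 2)%N.
  rewrite (leq_trans (size_polyD _ _)) // geq_max size_poly1 /=.
  by rewrite (leq_trans (size_scale_leq _ _)) // size_polyX.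
move: (size L) (size (L ^+ n.+1)) (size P) (size (P * _)) => a b c e.
move=> a2 /leq_trans/(_ (_ : _ <= n.+2)%N) b2 ec c2.
have {b2} : (b <= n.+2)%N by apply: b2; nia.
move: c2; rewrite /=; nia.
Qed.

(** Telescoping of [(s a)! = C(s a, a) a! ((s - 1) a)!]. *)
Lemma prod_bin_fact k a :
  ((\prod_(1 <= s < k.+1) 'C(s * a, a)) * a`! ^ k = (k * a)`!)%N.
Proof.
elim: k => [|k IH]; first by rewrite big_geq.
rewrite big_nat_recr //= expnS.
have le : (a <= k.+1 * a)%N by rewrite mulSn leq_addr.
by rewrite -(bin_fact le) [in (_ - _)%N]mulSn addKn -IH; ring.
Qed.

(** As [a < p], the factor [a! ^ k] is prime to [p], so [e_exp] is the valuation of [(k a)!]. In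
    Legendre's formula only the first term survives, because [k a < p^2]. *)
Lemma e_expE p k a : prime p -> (k < p)%N -> (a < p)%N -> e_exp p k a = (k * a %/ p)%N.
Proof.
move=> p_prime kp ap; have p_gt1 := prime_gt1 p_prime.
have logn0 : logn p (a`! ^ k) = 0%N.
  rewrite lognX logn_fact // big1_seq ?muln0 // => i.
  rewrite mem_index_iota => /andP[_ /andP[i_gt0 _]]; apply: divn_small.
  by rewrite (leq_trans ap) // -{1}(expn1 p) leq_exp2l.
have := congr1 (logn p) (prod_bin_fact k a).
rewrite lognM ?expn_gt0 ?fact_gt0 //; last first.
  rewrite big_nat_cond; apply: prodn_cond_gt0 => s /andP[/andP[s_gt0 _] _].
  by rewrite bin_gt0 leq_pmull.
rewrite logn0 addn0 /e_exp => ->; rewrite logn_fact //.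
have [->|ka_gt0] := posnP (k * a); first by rewrite big_geq ?div0n.
rewrite big_ltn // expn1 big1_seq ?addn0 // => i.
rewrite mem_index_iota => /andP[_ /andP[i_gt1 _]]; apply: divn_small.
by rewrite (@leq_trans (p ^ 2)) ?leq_exp2l //; nia.
Qed.

(** Logarithmic derivatives add up; the common denominator [V] keeps the identity among
    polynomials. *)
Lemma logderiv_prod (R : comNzRingType) (I : finType) (P : pred I) (f c : I -> {poly R})
    (V : {poly R}) :
    (forall i, P i -> (f i)^`() * V = f i * c i) ->
  (\prod_(i | P i) f i)^`() * V = (\prod_(i | P i) f i) * \sum_(i | P i) c i.
Proof.
move=> fc; elim/big_rec2: _ => [|i s q Pi IH].
  by rewrite derivC mul0r mulr0.
by rewrite derivM mulrDl mulrAC fc // -[_ * _ * V]mulrA IH; ring.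
Qed.

Lemma coef_comp_scaleX (R : comNzRingType) (q : {poly R}) (k : R) j :
  (q \Po (k *: 'X))`_j = k ^+ j * q`_j.
Proof.
rewrite coef_comp_poly.
under eq_bigr => i _ do rewrite exprZn coefZ coefXn.
have [jq|qj] := ltnP j (size q); last first.
  rewrite nth_default // mulr0 big1 // => i _.
  by rewrite gtn_eqF ?mulr0 // (leq_trans (ltn_ord i)).
rewrite (bigD1 (Ordinal jq)) //= eqxx mulr1 mulrC big1 ?addr0 // => i.
by rewrite -val_eqE eq_sym /= => /negPf->; rewrite !mulr0.
Qed.

Lemma frac_common_denominator (R : idomainType) n (f : 'I_n -> {fraction R}) :
  exists2 D : R, D != 0 & exists h : 'I_n -> R, forall i, f i * tofrac D = tofrac (h i).
Proof.
have frac1 (x : {fraction R}) : exists nd : R * R, nd.2 != 0 /\ x * tofrac nd.2 = tofrac nd.1.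
  elim/quotW: x => x; exists (frac x); split; first exact: denom_ratioP.
  unlock tofrac; rewrite -[LHS]FracField.pi_mul; apply/eqmodP => /=.
  rewrite FracField.equivfE /FracField.mulf /= !numden_Ratio ?oner_eq0 ?mulr1 ?denom_ratioP //.
  by rewrite mulrC.
have [nd ndP] := fin_all_exists (fun i => frac1 (f i)).
exists (\prod_i (nd i).2).
  by apply/prodf_neq0 => i _; case: (ndP i).
exists (fun i => (nd i).1 * \prod_(j | j != i) (nd j).2) => i.
by rewrite (bigD1 i) //= !rmorphM mulrA; case: (ndP i) => _ ->.
Qed.

(** * Products over nonzero residues and the differential equation of [T] *)

Section PrimeField.

Variable p : nat.
Hypothesis p_prime : prime p.

Local Notation F := 'F_p.
Local Notation t := (T F p).

(** Indexing by nonzero residues permits reindexing by multiplication by a unit. *)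
Lemma big_nat_Fp (R : Type) (idx : R) (op : Monoid.com_law idx) (h : F -> R) :
  \big[op/idx]_(1 <= i < p) h i%:R = \big[op/idx]_(a : F | a != 0) h a.
Proof.
have p_gt0 := prime_gt0 p_prime.
have E : \big[op/idx]_(i < p | (i : nat) != 0%N) h i%:R
       = \big[op/idx]_(1 <= i < p) h i%:R.
  rewrite -(big_mkord (fun i => i != 0%N) (fun i => h i%:R)) big_ltn_cond // /=.
  by rewrite big_nat_cond [RHS]big_nat_cond; apply: eq_bigl => -[].
rewrite -E.
rewrite -(big_mkord (fun i => i != 0%N) (fun i => h i%:R)) -{1}(Fp_cast p_prime).
rewrite big_mkord; apply: eq_big => [a|a _].
  by rewrite -val_eqE.
by rewrite natr_Zp.
Qed.

Lemma T_Fp : t = \prod_(a : F | a != 0) (1 + a^-1 *: 'X) ^+ a.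
Proof.
rewrite -(big_nat_Fp _ (fun a : F => (1 + a^-1 *: 'X) ^+ (a : nat))).
rewrite /T big_nat [RHS]big_nat; apply: eq_bigr => i /andP[_ ip].
by rewrite val_Fp_nat // modn_small.
Qed.

Lemma expf_p1 (a : F) : a != 0 -> a ^+ p.-1 = 1.
Proof.
move=> a0; have := expf_card a; rewrite card_Fp // => E.
by apply: (mulfI a0); rewrite mulr1 -exprS prednK ?prime_gt0.
Qed.

(** Up to a scalar, both sides are the product of the [X - a] over nonzero [a]; the value at 0 fixes
    the scalar. *)
Lemma prod_1DX_Fp :
  \prod_(a : F | a != 0) (1 + a^-1 *: 'X) = 1 - 'X^(p.-1) :> {poly F}.
Proof.
have E : \prod_(a : F | a != 0) ('X - a%:P) = 'X^(p.-1) - 1 :> {poly F}.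
  apply: (@mulfI _ 'X); first by rewrite polyX_eq0.
  rewrite mulrBr mulr1 -exprS prednK ?prime_gt0 //.
  rewrite -[X in 'X^X](card_Fp p_prime) finField_genPoly [RHS](bigD1 (0 : F)) //=.
  by rewrite polyC0 subr0.
have E2 : \prod_(a : F | a != 0) (1 + a^-1 *: 'X)
    = (\prod_(a : F | a != 0) a^-1) *: ('X^(p.-1) - 1) :> {poly F}.
  have opp_neq0 (a : F) : (- a != 0) = (a != 0) by rewrite oppr_eq0.
  rewrite -mul_polyC -E rmorph_prod (reindex_inj (@oppr_inj F)) /=.
  rewrite [X in _ = X * _](reindex_inj (@oppr_inj F)) /=.
  rewrite !(eq_bigl _ _ opp_neq0) -big_split /=; apply: eq_bigr => a a0.
  by rewrite mulrBr mul_polyC -rmorphM /= invrN mulNr mulVf // rmorphN /= opprK addrC.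
have := congr1 (fun q : {poly F} => q.[0]) E2.
rewrite hornerZ hornerD hornerN hornerXn hornerC expr0n.
have -> : (p.-1 == 0)%N = false by move: (prime_gt1 p_prime); lia.
rewrite sub0r mulrN1 horner_prod big1 => [c1|a _]; last first.
  by rewrite !hornerE.
by rewrite E2 -[X in X *: _]opprK -c1 scaleN1r opprB.
Qed.

(** The derivation of the overview is [D q = - V q']. *)
Local Notation V := (1 - 'X^(p.-1) : {poly F}).

Lemma V_neq0 : V != 0.
Proof.
apply/eqP => /(congr1 (fun q : {poly F} => q.[0])).
rewrite hornerD hornerN hornerXn !hornerC expr0n.
have -> : (p.-1 == 0)%N = false by move: (prime_gt1 p_prime); lia.
by rewrite subr0 => /eqP; rewrite oner_eq0.
Qed.

Lemma natr_Fp_eq0 n : (n%:R == 0 :> F) = (p %| n)%N.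
Proof. by rewrite (dvdn_pcharf (pchar_Fp p_prime)). Qed.

Lemma natr_p1 : p.-1%:R = -1 :> F.
Proof.
apply/eqP; rewrite -addr_eq0 natr1 prednK ?prime_gt0 //.
by rewrite pchar_Fp_0.
Qed.

(** The exponent [a] cancels the [a^-1] produced by differentiating its factor, so [T'/T] is the sum
    of the [1/(1 + X/a)]. With [W a] standing for [V/(1 + X/a)], this sum is [-1/V]. *)
Lemma deriv_T : t^`() * V = - t.
Proof.
pose W a : {poly F} := \prod_(b : F | (b != 0) && (b != a)) (1 + b^-1 *: 'X).
have VW a : a != 0 -> V = (1 + a^-1 *: 'X) * W a.
  by move=> a0; rewrite -prod_1DX_Fp (bigD1 a).
have dlin (a : F) : (1 + a^-1 *: 'X)^`() = a^-1%:P :> {poly F}.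
  by rewrite derivD derivZ derivX derivC add0r alg_polyC.
have VE : V^`() = \sum_(a : F | a != 0) a^-1 *: W a.
  apply: (mulIf V_neq0); rewrite [RHS]mulrC -prod_1DX_Fp; apply: logderiv_prod => a a0.
  by rewrite prod_1DX_Fp dlin (VW a a0) -!mul_polyC; ring.
(* Summing [V = W a + X a^-1 W a] over the p - 1 values of [a] gives [- V - X V'] for the sum of the
   [W a], and [V' = X^(p-2)]. *)
have WE : \sum_(a : F | a != 0) W a = -1.
  have : \sum_(a : F | a != 0) V = \sum_(a : F | a != 0) (W a + 'X * (a^-1 *: W a)).
    apply: eq_bigr => a a0; rewrite {1}(VW a a0) -!mul_polyC; ring.
  rewrite [RHS]big_split /= -mulr_sumr -VE sumr_const.
  rewrite (eq_card (B := predC1 (0 : F))) // cardC1 card_Fp //.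
  rewrite -mulr_natl -polyC_natr natr_p1 polyCN mulN1r.
  rewrite derivB derivC derivXn -[in 'X * _]mulr_natl -polyC_natr natr_p1.
  have -> : 'X^(p.-1) = 'X * 'X^(p.-1.-1) :> {poly F}.
    by rewrite -exprS; congr ('X^ _); move: (prime_gt1 p_prime); lia.
  rewrite polyCN polyC1 => E.
  by apply: (addIr ('X * (0 - -1 * 'X^(p.-1.-1)))); rewrite -E; ring.
rewrite T_Fp -[RHS]mulrN1 -WE; apply: logderiv_prod => a a0.
rewrite deriv_exp dlin (VW a a0).
have -> : (1 + a^-1 *: 'X) ^+ a = (1 + a^-1 *: 'X) * (1 + a^-1 *: 'X) ^+ a.-1 :> {poly F}.
  by rewrite -exprS prednK // lt0n; apply: contra a0 => a0; rewrite -val_eqE.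
have : a%:R * a^-1%:P = 1 :> {poly F}.
  by rewrite -polyC_natr natr_Zp -polyCM divff.
move=> E; rewrite -[X in X * _ = _]mulr_natl.
by rewrite [X in X * _ = _]mulrA E mul1r; ring.
Qed.

(** * Vanishing of coefficients of [T] *)

Lemma coef_T_rec m r : (0 < r)%N ->
  r.+1%:R * t`_(p * m + r.+1) = r%:R * t`_(p * m.+1 + r) + t`_(p * m.+1 + r.-1).
Proof.
move=> r_gt0; have p_gt1 := prime_gt1 p_prime.
have mulp n : (p * n)%:R = 0 :> F by rewrite natrM pchar_Fp_0 // mul0r.
(* In this coefficient the factors brought down by differentiation are congruent to [r] and [r + 1]
   modulo p. *)
have := congr1 (fun q : {poly F} => q`_(p * m.+1 + r.-1)) deriv_T.
rewrite coefN mulrC mulrBl mul1r coefB coefXnM coef_deriv.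
have -> : (p * m.+1 + r.-1).+1 = (p * m.+1 + r)%N by lia.
rewrite leqNgt (_ : (_ < _)%N) /=; last first.
  by rewrite mulnS -addnA (leq_trans _ (leq_addr _ _)) // prednK // ltnW.
rewrite coef_deriv.
have -> : (p * m.+1 + r.-1 - p.-1).+1 = (p * m + r.+1)%N by rewrite mulnS; lia.
rewrite -[X in X - _]mulr_natl -[X in _ - X]mulr_natl !natrD !mulp !add0r => E.
by rewrite -[t`_(_ + r.-1)]opprK -E; ring.
Qed.

Lemma coef_T_large j : (p * p.-1 < j.*2)%N -> t`_j = 0.
Proof.
move=> lt; apply: nth_default.
suff le : ((size t).-1.*2 <= p * p.-1)%N.
  have := leq_ltn_trans le lt; rewrite ltn_double.
  by case: (size t) => //.
exact: size_T.
Qed.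

(** The recurrence passes from [(m, r)] to [(m + 1, r - 1)] and [(m + 1, r - 2)], and neither
    decreases [2m + r]. For [r <= 1] the exponent already exceeds the degree of [T]. *)
Lemma coef_T_eq0 m r : (r < p)%N -> (p <= 2 * m + r)%N -> t`_(p * m + r) = 0.
Proof.
elim/ltn_ind: r m => -[|[|r]] IH m rp le.
- apply: coef_T_large; nia.
- apply: coef_T_large; nia.
have : r.+2%:R * t`_(p * m + r.+2) = 0.
  rewrite coef_T_rec // !IH ?mulr0 ?addr0 //; lia.
move/eqP; rewrite mulf_eq0 => /orP[|/eqP//].
rewrite natr_Fp_eq0 gtnNdvd //.
Qed.

Lemma coef_T0 : t`_0 = 1.
Proof.
rewrite -horner_coef0 /T horner_prod big1_seq // => i _.
by rewrite horner_exp !hornerE expr1n.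
Qed.

Lemma coef_T1 : (2 < p)%N -> t`_1 = -1.
Proof.
move=> p_gt2; have := congr1 (fun q : {poly F} => q`_0) deriv_T.
rewrite coefN coef_T0 coef0M coefB coef1 coefXn coef_deriv mulr1n.
have -> : (0 == p.-1)%N = false by lia.
by rewrite subr0 mulr1.
Qed.

(** * Power sums over F_p and the monomials of [S_e] *)

Lemma sum_expr_Fp n : ~~ (p.-1 %| n)%N -> \sum_(k : F | k != 0) k ^+ n = 0.
Proof.
move=> ndiv; have p_gt1 := prime_gt1 p_prime.
(* Otherwise [X^(n mod (p-1)) - 1] would have p - 1 roots, more than its degree. *)
have [c c0 cn] : exists2 c : F, c != 0 & c ^+ n != 1.
  apply/exists_inP; apply: contraNT ndiv; rewrite negb_exists_in => /forall_inP all1.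
  rewrite /dvdn -leqn0 leqNgt; apply/negP => s_gt0.
  have s_lt : (n %% p.-1 < p.-1)%N by rewrite ltn_mod; lia.
  have mono : 'X^(n %% p.-1) - 1 != 0 :> {poly F}.
    by rewrite -size_poly_eq0 size_XnsubC.
  have roots : all (root ('X^(n %% p.-1) - 1 : {poly F})) (enum (predC1 (0 : F))).
    apply/allP => a; rewrite mem_enum => a0; apply/rootP.
    rewrite hornerD hornerN hornerXn hornerC.
    have := all1 a a0; rewrite negbK {1}(divn_eq n p.-1) exprD mulnC exprM.
    by rewrite expf_p1 // expr1n mul1r => /eqP->; rewrite subrr.
  have := max_poly_roots mono roots (enum_uniq _).
  rewrite size_XnsubC // -cardE cardC1 card_Fp //; lia.
(* Replacing [k] by [c k] multiplies the sum by [c^n]. *)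
apply/eqP; have : c ^+ n * (\sum_(k : F | k != 0) k ^+ n) = \sum_(k : F | k != 0) k ^+ n.
  rewrite mulr_sumr [RHS](reindex_inj (mulfI c0)) /=.
  by apply: eq_big => [k|k _]; rewrite ?mulf_eq0 ?(negPf c0) ?exprMn.
rewrite -[X in _ = X]mul1r; set s := \sum_(k | _) _.
by move/eqP; rewrite -subr_eq0 -mulrBl mulf_eq0 subr_eq0 (negPf cn).
Qed.

Definition scaled_T_sum (e : nat) : {poly F} :=
  \sum_(k : F | k != 0) k ^- e *: (t \Po (k *: 'X)).

(* The span of the monomials [(X^p)^m X^(d-m)], [m <= d]. *)
Definition graded (d : nat) (q : {poly F}) : Prop :=
  forall j, q`_j != 0 -> exists2 m, (m <= d)%N & j = (p.-1 * m + d)%N.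

(** Writing [k^-e] as [k^(p-1-e)] gives a power sum with a natural exponent. *)
Lemma coef_scaled_T_sum e j : (e < p)%N ->
  (scaled_T_sum e)`_j = (\sum_(k : F | k != 0) k ^+ (j + (p.-1 - e))) * t`_j.
Proof.
move=> ep; rewrite coef_sum mulr_suml; apply: eq_bigr => k k0.
rewrite coefZ coef_comp_scaleX mulrA; congr (_ * _).
rewrite exprD mulrC; congr (_ * _); apply: (mulfI (expf_neq0 e k0)).
rewrite divff ?expf_neq0 // -exprD subnKC ?expf_p1 //.
by rewrite -ltnS prednK // prime_gt0.
Qed.

(** Let [j = p m + r] with [r < p]. A nonzero coefficient forces [2m + r < p] and p - 1 to divide
    [N = m + r + (p - 1 - e)]. Since [0 < N < 2(p - 1)], we get [N = p - 1], that is [m + r = e]. *)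
Lemma graded_scaled_T_sum e : (0 < e < p.-1)%N -> graded e (scaled_T_sum e).
Proof.
case/andP=> e_gt0 e_lt j; rewrite coef_scaled_T_sum; last by lia.
rewrite mulf_eq0 negb_or => /andP[sj tj].
have p_gt0 := prime_gt0 p_prime.
have jE : j = (p * (j %/ p) + j %% p)%N by rewrite mulnC -divn_eq.
have r_lt : (j %% p < p)%N by rewrite ltn_mod.
have w_lt : (2 * (j %/ p) + j %% p < p)%N.
  by rewrite ltnNge; apply: contraNN tj => le; rewrite jE coef_T_eq0.
have /dvdnP[c] : (p.-1 %| j + (p.-1 - e))%N.
  by apply: contraNT sj => /sum_expr_Fp->.
set m := (j %/ p)%N in jE w_lt *; set r := (j %% p)%N in jE r_lt w_lt *.
have pE : (p * m = m * p.-1 + m)%N by rewrite -{1}(prednK p_gt0) mulSn addnC mulnC.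
rewrite jE pE -!addnA; set N := (m + _)%N => cE.
have {cE} cN : ((c - m) * p.-1 = N)%N by rewrite mulnBl -cE addKn.
have /eqP cm : (c - m == 1)%N.
  have P_gt0 : (0 < p.-1)%N by lia.
  have N_gt0 : (0 < N)%N by rewrite /N; lia.
  have N_lt : (N < 2 * p.-1)%N by rewrite /N; lia.
  move: N_gt0 N_lt; rewrite -cN muln_gt0 P_gt0 andbT ltn_pmul2r //.
  by clear; lia.
move: cN; rewrite cm mul1n /N => NE; exists m; clear -NE e_gt0 e_lt; lia.
Qed.

(** The substitution of [k X] for [X] fixes [V], as [k^(p-1) = 1], and the chain rule supplies one
    factor [k]. *)
Lemma deriv_scaled_T_sum e : (scaled_T_sum e.+1)^`() * V = - scaled_T_sum e.
Proof.
rewrite linear_sum /= mulr_suml -sumrN; apply: eq_bigr => k k0.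
rewrite derivZ deriv_comp derivZ derivX.
have := congr1 (fun q => q \Po (k *: 'X)) deriv_T.
rewrite /= rmorphM rmorphN rmorphB /= comp_polyC comp_Xn_poly exprZn expf_p1 // scale1r => E.
by rewrite -scalerN -E -scalerAr mulr1 scalerA -scalerAl exprS invfM mulrAC mulVf ?mul1r.
Qed.

(** Each summand contains [T(-k)], whose factor at [a = k] is zero. *)
Lemma scaled_T_sum_root e : (scaled_T_sum e).[-1] = 0.
Proof.
rewrite horner_sum big1 // => k k0; rewrite hornerZ horner_comp.
apply/eqP; rewrite mulf_eq0 T_Fp horner_prod; apply/orP; right.
apply/prodf_eq0; exists k => //; rewrite horner_exp expf_eq0 lt0n.
apply/andP; split; first by apply: contra k0 => k0; rewrite -val_eqE.
by rewrite hornerD !hornerZ !hornerX hornerC mulrN1 mulrN mulVf // subrr.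
Qed.

Lemma gradedD d q1 q2 : graded d q1 -> graded d q2 -> graded d (q1 + q2).
Proof.
move=> g1 g2 j; rewrite coefD => nz.
have [z1|] := eqVneq q1`_j 0; last exact: g1.
by apply: g2; apply: contra_neq nz => ->; rewrite z1 addr0.
Qed.

Lemma gradedZ d c q : graded d q -> graded d (c *: q).
Proof. by move=> gq j; rewrite coefZ mulf_eq0 negb_or => /andP[_]; apply: gq. Qed.

Lemma graded_sum d (I : finType) (f : I -> {poly F}) :
  (forall i, graded d (f i)) -> graded d (\sum_i f i).
Proof.
move=> gf; apply: (big_ind (graded d)) => //; last exact: gradedD.
by move=> j; rewrite coef0 eqxx.
Qed.

Lemma gradedM d e q1 q2 : graded d q1 -> graded e q2 -> graded (d + e) (q1 * q2).
Proof.
move=> g1 g2 j; rewrite coefM => nz.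
have /existsP[i] : [exists i : 'I_j.+1, q1`_i * q2`_(j - i) != 0].
  apply: contraNT nz; rewrite negb_exists => /forallP nz.
  by apply/eqP; apply: big1 => i _; apply/eqP; rewrite -[_ == _]negbK nz.
rewrite mulf_eq0 negb_or => /andP[/g1[m1 l1 E1] /g2[m2 l2 E2]].
exists (m1 + m2)%N; first by lia.
by have := ltn_ord i; rewrite mulnDr; lia.
Qed.

Lemma gradedXp r : graded r 'X^(p * r).
Proof.
move=> j; rewrite coefXn; case: (eqVneq j) => [-> _|_]; last by rewrite eqxx.
by exists r; rewrite // addnC -mulSn prednK // prime_gt0.
Qed.

(** The grading leaves only [X] and [X^p]. The first coefficient is [(p - 1)(-1) = 1], and the root
    -1 determines the second. *)
Lemma scaled_T_sum1 : (2 < p)%N -> scaled_T_sum 1 = 'X - 'X^p.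
Proof.
move=> p_gt2; have p1E : (p.-1 * 1 + 1 = p)%N by lia.
have c1 : (scaled_T_sum 1)`_1 = 1.
  rewrite coef_scaled_T_sum; last by lia.
  rewrite coef_T1 // subnKC; last by lia.
  rewrite (eq_bigr (fun=> 1)); last by move=> k; apply: expf_p1.
  rewrite sumr_const (eq_card (B := predC1 (0 : F))) // cardC1 card_Fp //.
  by rewrite natr_p1 mulrNN mulr1.
have gL : graded 1 (scaled_T_sum 1) by apply: graded_scaled_T_sum; lia.
have E : scaled_T_sum 1 = 'X + (scaled_T_sum 1)`_p *: 'X^p.
  apply/polyP => j; rewrite coefD coefZ coefX coefXn.
  have [-> |j1] := eqVneq j 1%N.
    by rewrite c1 (_ : (1 == p)%N = false) ?mulr0 ?addr0 //; lia.
  have [-> |jp] := eqVneq j p; first by rewrite mulr1 add0r.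
  rewrite mulr0 addr0; apply/eqP/contraT => /gL[m].
  by case: m => [|[|//]]; lia.
have := scaled_T_sum_root 1; rewrite E hornerD hornerZ hornerX hornerXn.
rewrite -signr_odd; case: (even_prime p_prime) => [|->]; first by lia.
rewrite expr1 mulrN1 => /eqP; rewrite subr_eq0 => /eqP <-.
by rewrite scaleN1r.
Qed.

(** * The identity in F_p[X] *)

Definition stirling_sum (d : nat) : {poly F} :=
  \sum_(r < d) (stirling1 d r.+1)%:~R *: ('X^(p * r) * scaled_T_sum (d - r)).

(** Frobenius turns [alpha^r] into [X^(p r)], a constant for the derivation, so differentiating only
    lowers the index of [S]. The Stirling recurrence then splits the result into the two terms. *)
Lemma deriv_stirling_sum d : (0 < d)%N ->
  (stirling_sum d.+1)^`() * V = 'X^p * ((stirling_sum d)^`() * V) - d%:R *: stirling_sum d.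
Proof.
move=> d_gt0.
have derivU n : (stirling_sum n)^`() * V =
    - \sum_(r < n) (stirling1 n r.+1)%:~R *: ('X^(p * r) * scaled_T_sum (n - r).-1).
  rewrite linear_sum /= mulr_suml -sumrN; apply: eq_bigr => r _.
  rewrite derivZ derivM derivXn -[_ *+ (p * r)]mulr_natl natrM.
  rewrite -[p%:R]polyC_natr pchar_Fp_0 // !mul0r add0r -scalerAl -scalerN; congr (_ *: _).
  rewrite -mulrA -mulrN -deriv_scaled_T_sum; congr (_ * (_^`() * _)).
  by rewrite prednK // subn_gt0.
rewrite !derivU mulrN -opprD; congr (- _).
(* The added term [r = d] is zero, as [stirling1 d d.+1 = 0]. *)
have -> : d%:R *: stirling_sum d = \sum_(r < d.+1)
    (d%:R * stirling1 d r.+1)%:~R *: ('X^(p * r) * scaled_T_sum (d - r)).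
  rewrite big_ord_recr /= stirling1_large // mulr0 scale0r addr0 scaler_sumr.
  by apply: eq_bigr => r _; rewrite scalerA rmorphM rmorph_nat.
(* The factor [X^p] shifts [r] by one; the new term [r = 0] is zero, as [stirling1 d 0 = 0]. *)
have -> : 'X^p * \sum_(r < d) (stirling1 d r.+1)%:~R *: ('X^(p * r) * scaled_T_sum (d - r).-1)
  = \sum_(r < d.+1) (stirling1 d r)%:~R *: ('X^(p * r) * scaled_T_sum (d - r)).
  rewrite big_ord_recl /= stirling1_0 // scale0r add0r mulr_sumr.
  apply: eq_bigr => r _; rewrite -scalerAr mulrA -exprD -mulnS.
  by rewrite /bump /= add1n subnS.
rewrite -big_split /=; apply: eq_bigr => r _.
by rewrite -scalerDl -intrD stirling1S subSn // -ltnS.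
Qed.

Lemma gradedX n q : graded 1 q -> graded n (q ^+ n).
Proof.
move=> gq; elim: n => [j|n IH]; last by rewrite exprS -add1n; apply: gradedM.
rewrite coef1; case: (eqVneq j) => [-> _|_]; last by rewrite eqxx.
by exists 0%N; rewrite // muln0.
Qed.

(** Differentiating [X^(p m + (d - m))] brings down [d - m], a unit unless [m = d]. So [q] is a
    multiple of [X^(p d)], which does not vanish at -1. *)
Lemma graded_deriv0 d q : (0 < d < p.-1)%N ->
  graded d q -> q^`() = 0 -> q.[-1] = 0 -> q = 0.
Proof.
case/andP=> d_gt0 d_lt gq dq rq.
have p_gt0 := prime_gt0 p_prime.
have p1E m : (p.-1 * m + m = p * m)%N by rewrite addnC -mulSn prednK.
have E : q = q`_(p * d) *: 'X^(p * d).
  apply/polyP => j; rewrite coefZ coefXn.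
  have [-> |jd] := eqVneq j; first by rewrite mulr1.
  rewrite mulr0; apply/eqP/contraT => qj; have [m md jE] := gq j qj.
  have m_lt : (m < d)%N.
    by rewrite ltn_neqAle md andbT; apply: contra jd => /eqP mE; rewrite jE -mE p1E.
  have := congr1 (fun q : {poly F} => q`_j.-1) dq.
  rewrite coef_deriv coef0 prednK; last by lia.
  move/eqP; rewrite -mulr_natl mulf_eq0 (negPf qj) orbF jE.
  rewrite (_ : (_ + d = p * m + (d - m))%N); last by rewrite -p1E; lia.
  rewrite natrD natrM pchar_Fp_0 // mul0r add0r.
  rewrite natr_Fp_eq0 gtnNdvd //; lia.
move: rq; rewrite E hornerZ hornerXn => /eqP.
by rewrite mulf_eq0 signr_eq0 orbF => /eqP->; rewrite scale0r.
Qed.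

(** In the induction step [graded_deriv0] is applied to the difference of the two sides: it is
    graded, has zero derivative by [deriv_stirling_sum], and vanishes at -1. *)
Lemma scaled_T_sum_power d : (0 < d < p.-1)%N ->
  d%:R^-1 *: ('X - 'X^p) ^+ d = (-1) ^+ d.-1 *: stirling_sum d.
Proof.
elim: d => // -[_|d IH] d_lt.
  rewrite invr1 !scale1r expr1 /stirling_sum big_ord1 muln0 mul1r subn0 scaled_T_sum1; last by lia.
  by rewrite /stirling1 big_ord1 addr0 coefX scale1r.
have d1_lt : (0 < d.+1 < p.-1)%N by lia.
have UE : stirling_sum d.+1 = ((-1) ^+ d / d.+1%:R) *: ('X - 'X^p) ^+ d.+1.
  by rewrite -scalerA IH // scalerA -expr2 sqrr_sign scale1r.
have nz n : (0 < n < p)%N -> n%:R != 0 :> F.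
  by case/andP=> n0 np; rewrite natr_Fp_eq0 gtnNdvd.
have dY n : (('X - 'X^p) ^+ n.+1)^`() = n.+1%:R *: ('X - 'X^p) ^+ n :> {poly F}.
  rewrite deriv_exp derivB derivX derivXn -[_ *+ p]mulr_natl -[p%:R]polyC_natr pchar_Fp_0 //.
  by rewrite mul0r subr0 mul1r -scaler_nat.
apply/eqP; rewrite -subr_eq0; apply/eqP; apply: (graded_deriv0 d_lt).
- rewrite -scaleNr; apply: gradedD; apply: gradedZ.
    by apply: gradedX; rewrite -scaled_T_sum1; [apply: graded_scaled_T_sum|]; lia.
  apply: graded_sum => r; apply: gradedZ; have := ltn_ord r => r_lt.
  rewrite -{1}(subnKC (ltnW r_lt)); apply: gradedM; first exact: gradedXp.
  by apply: graded_scaled_T_sum; lia.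
- apply: (mulIf V_neq0); rewrite mul0r derivB !derivZ mulrBl -!scalerAl deriv_stirling_sum //.
  rewrite UE derivZ !dY.
  rewrite -scalerAl scalerA mulVf ?nz ?scale1r //; last by lia.
  have d1_neq0 : d.+1%:R != 0 :> F by rewrite nz //; lia.
  rewrite [X in X * V]scalerA mulfVK // [d.+1%:R *: _]scalerA [d.+1%:R * _]mulrCA divff // mulr1.
  rewrite -scalerAl -scalerAr -scalerBr scalerA -exprD -signr_odd.
  rewrite addSn addnn /= odd_double /= expr1 scaleN1r.
  (* With [Y = X - X^p = X V], the remaining identity is [Y^(d+1) V = Y^d (Y - X^p V)]. *)
  have -> : 'X^p = 'X * 'X^(p.-1) :> {poly F} by rewrite -exprS prednK ?prime_gt0.
  by rewrite exprS; ring.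
(* At -1 the left side vanishes because p is odd, the right side because every [S_e] does. *)
rewrite hornerD hornerN !hornerZ horner_exp hornerD hornerN hornerX hornerXn.
have p_odd : odd p by case: (even_prime p_prime) d_lt => [->|].
rewrite -[(-1) ^+ p]signr_odd p_odd expr1 subrr expr0n mulr0 sub0r horner_sum big1 ?mulr0 ?oppr0 //.
by move=> r _; rewrite hornerZ hornerM scaled_T_sum_root !mulr0.
Qed.

(** Reindexing by [a -> k a] turns the factor at [a] into [1 + k X/(k a)], with exponent the residue
    of [k a]. *)
Lemma T_scale k : (0 < k < p)%N ->
  t \Po (k%:R *: 'X) = \prod_(1 <= i < p) (1 + i%:R^-1 *: 'X) ^+ (k * i %% p).
Proof.
case/andP=> k_gt0 kp; have k0 : k%:R != 0 :> F by rewrite natr_Fp_eq0 gtnNdvd.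
rewrite T_Fp // rmorph_prod /= (reindex_inj (mulfI k0)) /=.
rewrite (eq_bigl (fun a : F => a != 0)); last by move=> a; rewrite mulf_eq0 (negPf k0).
rewrite -(big_nat_Fp _
  (fun a : F => ((1 + (k%:R * a)^-1 *: 'X) ^+ (k%:R * a)%R) \Po (k%:R *: 'X))).
apply: eq_bigr => i _; rewrite -natrM val_Fp_nat // rmorphXn /=; congr (_ ^+ _).
rewrite rmorphD /= comp_polyC comp_polyZ comp_polyX scalerA natrM invfM.
by rewrite mulrAC mulVf // mul1r.
Qed.

(** * Independence of the powers of [T] over the p-th powers *)

Lemma T_neq0 : t != 0.
Proof. by apply/eqP => t0; have := coef_T0; rewrite t0 coef0 => /esym/eqP; rewrite oner_eq0. Qed.

(* The summands satisfy [D v_i = i v_i], so [D] turns a relation weighted by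
   [q(i)] into one weighted by [i q(i)]; [1 - (X - i0)^(p-1)] then isolates [i0]. *)
Lemma T_powers_free (h : 'I_p -> {poly F}) :
  \sum_i h i ^+ p * t ^+ i = 0 -> forall i, h i = 0.
Proof.
move=> sum0 i0; pose v i := h i ^+ p * t ^+ i.
have dv i : (v i)^`() * V = - (i%:R *: v i).
  rewrite derivM !deriv_exp -[_ *+ p]mulr_natl -[p%:R]polyC_natr pchar_Fp_0 // !mul0r.
  rewrite add0r -[_ *+ i]mulr_natl -mulrA -mulrA [_ * t ^+ _ * V]mulrAC deriv_T //.
  rewrite /v; case: (val i) => [|n]; first by rewrite !mul0r mulr0 scale0r oppr0.
  by rewrite -mul_polyC polyC_natr exprS; ring.
have key (q : {poly F}) : \sum_(i < p) q.[i%:R] *: v i = 0.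
  elim/poly_ind: q => [|q c IH]; first by rewrite big1 // => i _; rewrite horner0 scale0r.
  have := congr1 (fun s : {poly F} => s^`() * V) IH.
  rewrite /= linear_sum linear0 mul0r mulr_suml /=.
  under eq_bigr => i _ do rewrite derivZ -scalerAl dv scalerN scalerA.
  rewrite sumrN => /eqP; rewrite oppr_eq0 => /eqP E.
  under eq_bigr => i _ do rewrite hornerMXaddC scalerDl.
  by rewrite big_split /= E add0r -scaler_sumr sum0 scaler0.
have := key (1 - ('X - i0%:R%:P) ^+ p.-1); rewrite (bigD1 i0) //= big1 => [|i ne].
  rewrite hornerD hornerN horner_exp hornerXsubC hornerC subrr expr0n.
  have -> : (p.-1 == 0)%N = false by move: (prime_gt1 p_prime); lia.
  rewrite subr0 scale1r addr0 => /eqP.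
  by rewrite mulf_eq0 !expf_eq0 (negPf T_neq0) andbF orbF => /andP[_ /eqP].
rewrite hornerD hornerN horner_exp hornerXsubC hornerC expf_p1 ?subrr ?scale0r //.
rewrite subr_eq0; apply: contra ne => /eqP/(congr1 val).
by rewrite /= !val_Fp_nat // !modn_small // => E; apply/eqP/val_inj.
Qed.

(** * The Frobenius evaluation and its injectivity in low degree *)

Local Notation K := (Fpa p).
Local Notation iota := (@tofrac {poly F}).

Lemma pchar_Fpa : p \in [pchar K].
Proof.
apply: (rmorph_pchar (@tofrac _)); apply: (rmorph_pchar (@polyC _)).
exact: pchar_Fp.
Qed.

Local Notation frob := (pFrobenius_aut pchar_Fpa).

(** Modulo [Y^p - T(alpha)] this computes the p-th power of [q(Y)]: raising to the p-th power
    applies Frobenius to the coefficients and replaces [Y] by [Y^p]. *)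
Definition frob_eval (q : {poly K}) : K := (map_poly frob q).[iota t].

Lemma iota_lin i : iota (1 + i%:R^-1 *: 'X) = 1 + alpha p / i%:R.
Proof.
rewrite rmorphD rmorph1 -mul_polyC rmorphM /= mulrC; congr (1 + _ * _).
by rewrite -[LHS]/((iota \o polyC) _) fmorphV rmorph_nat.
Qed.

Lemma horner_T_alpha : (T K p).[alpha p] = iota t.
Proof.
rewrite /T horner_prod rmorph_prod; apply: eq_bigr => i _.
by rewrite horner_exp rmorphXn /= iota_lin !hornerE mulrC.
Qed.

(** At each [a] the exponent is [k a - p floor(k a / p)], the remainder that occurs in [T_scale]. *)
Lemma frob_g k : (0 < k < p)%N ->
  frob (g p k) * iota t ^+ k = iota (t \Po (k%:R *: 'X)).
Proof.
move=> kp; rewrite T_scale // pFrobenius_autE /g /T !rmorph_prod /= -!prodrXl -big_split /=.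
rewrite big_nat [RHS]big_nat; apply: eq_bigr => a /andP[a_gt0 ap].
have u0 : 1 + alpha p / a%:R != 0.
  rewrite -iota_lin tofrac_eq0; apply/eqP => /(congr1 (fun q : {poly F} => q`_0)).
  by rewrite coefD coefZ coefX coef1 coef0 mulr0 addr0 => /eqP; rewrite oner_eq0.
rewrite !rmorphXn /= iota_lin e_expE //; last by case/andP: kp.
move: (1 + _) u0 => u u0.
rewrite exprVn -!exprM [(a * k)%N]mulnC [in X in _ * X = _](divn_eq (k * a) p) exprD.
by rewrite mulKf ?expf_neq0.
Qed.

Lemma frob_eval_pounds (e : nat) : frob_eval (pounds p e) = iota (scaled_T_sum e).
Proof.
rewrite /frob_eval /pounds rmorph_sum horner_sum /= /scaled_T_sum.
rewrite -(big_nat_Fp _ (fun k : F => k ^- e *: (t \Po (k *: 'X)))).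
rewrite rmorph_sum /= big_nat [RHS]big_nat; apply: eq_bigr => k kp.
rewrite map_polyZ map_polyXn hornerZ hornerXn.
(* Frobenius fixes the prime field. *)
have frobM : frob (g p k / k%:R ^+ e) = frob (g p k) / k%:R ^+ e.
  rewrite !pFrobenius_autE exprMn; congr (_ * _).
  by rewrite exprVn -exprM mulnC exprM -!(pFrobenius_autE pchar_Fpa) rmorph_nat.
rewrite -exprnP /= frobM mulrAC frob_g // -[_ ^- e *: _]mul_polyC rmorphM /= mulrC; congr (_ * _).
by rewrite -[RHS]/((iota \o polyC) _) fmorphV rmorphXn rmorph_nat.
Qed.

Lemma frob_eval_modulus : frob_eval ('X^p - ((T K p).[alpha p])%:P) = 0.
Proof.
rewrite /frob_eval rmorphB /= map_polyXn map_polyC /= hornerD hornerN hornerXn hornerC.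
by rewrite horner_T_alpha pFrobenius_autE subrr.
Qed.

(** For a common denominator [D] of the coefficients, multiplying by [D^p] gives a relation between
    the [h_i^p T^i], to which [T_powers_free] applies. *)
Lemma frob_eval_inj (q : {poly K}) : (size q <= p)%N -> frob_eval q = 0 -> q = 0.
Proof.
move=> q_le; rewrite /frob_eval (horner_coef_wide (n := p)); last first.
  by rewrite size_map_poly.
move=> q0; have [D D0 [h hE]] := frac_common_denominator (fun i : 'I_p => q`_i).
have h0 : forall i, h i = 0.
  apply: (T_powers_free (h := h)); apply/eqP; rewrite -tofrac_eq0; apply/eqP.
  have := congr1 (fun x => x * iota D ^+ p) q0; rewrite /= mul0r mulr_suml => E.
  rewrite rmorph_sum /= -[RHS]E; apply: eq_bigr => i _.
  by rewrite coef_map /= pFrobenius_autE rmorphM !rmorphXn /= -hE exprMn; ring.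
apply/polyP => i; rewrite coef0; have [ip|pi] := ltnP i p; last first.
  by rewrite nth_default // (leq_trans q_le).
apply/eqP; have /eqP := hE (Ordinal ip).
by rewrite h0 rmorph0 mulf_eq0 tofrac_eq0 (negPf D0) orbF.
Qed.

End PrimeField.

Theorem theorem5 (p : nat) (p_prime : prime p) (p_odd : odd p)
    (d : nat) (d_gt0 : (0 < d)%N) (d_lt : (d < p - 1)%N) :
  ((d%:R : Fpa p)^-1 *: pounds p 1 ^+ d)
    %% ('X^p - ((T (Fpa p) p).[alpha p])%:P)
  = ((-1) ^+ (d - 1) *
      \sum_(r < d)
        ((stirling1 d r.+1)%:~R * alpha p ^+ r) *: pounds p (d%:Z - r%:Z))
    %% ('X^p - ((T (Fpa p) p).[alpha p])%:P).
Proof.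
set M := 'X^p - _; set L := _ *: _; set R := (-1) ^+ _ * _.
(* The goal becomes the vanishing of the remainder of [L - R], whose degree is less than p. *)
apply/eqP; rewrite -subr_eq0 -modpN -modpD; apply/eqP.
apply: (@frob_eval_inj p p_prime).
  rewrite -ltnS.
  have <- : size M = p.+1 by rewrite size_XnsubC ?prime_gt0.
  by rewrite ltn_modpN0 // -size_poly_eq0 size_XnsubC ?prime_gt0.
have evM q1 q2 : frob_eval p_prime (q1 * q2) = frob_eval p_prime q1 * frob_eval p_prime q2.
  by rewrite /frob_eval rmorphM hornerM.
have evB q1 q2 : frob_eval p_prime (q1 - q2) = frob_eval p_prime q1 - frob_eval p_prime q2.
  by rewrite /frob_eval rmorphB hornerD hornerN.
have evD q1 q2 : frob_eval p_prime (q1 + q2) = frob_eval p_prime q1 + frob_eval p_prime q2.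
  by rewrite /frob_eval rmorphD hornerD.
have evZ c q : frob_eval p_prime (c *: q)
    = pFrobenius_aut (pchar_Fpa p_prime) c * frob_eval p_prime q.
  by rewrite /frob_eval map_polyZ hornerZ.
have evX q n : frob_eval p_prime (q ^+ n) = frob_eval p_prime q ^+ n.
  by rewrite /frob_eval rmorphXn horner_exp.
have p_gt2 : (2 < p)%N by lia.
have dd : (0 < d < p.-1)%N by lia.
have evL : frob_eval p_prime L = tofrac (d%:R^-1 *: ('X - 'X^p) ^+ d).
  rewrite evZ evX (frob_eval_pounds p_prime 1) scaled_T_sum1 // fmorphV rmorph_nat -mul_polyC.
  rewrite rmorphM rmorphXn /=; congr (_ * _).
  by rewrite -[RHS]/((@tofrac _ \o polyC) _) fmorphV rmorph_nat.
have evR : frob_eval p_prime R = tofrac ((-1) ^+ d.-1 *: stirling_sum p d).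
  rewrite evM evX subn1.
  have -> : frob_eval p_prime (-1) = -1.
    by rewrite /frob_eval rmorphN rmorph1 hornerN hornerC.
  rewrite -mul_polyC rmorphM /=.
  congr (_ * _).
    by rewrite polyC_exp polyCN rmorphXn rmorphN !rmorph1.
  rewrite /stirling_sum rmorph_sum [LHS]/frob_eval rmorph_sum horner_sum /=.
  apply: eq_bigr => r _; rewrite -[LHS]/(frob_eval p_prime _) evZ.
  rewrite subzn ?(ltnW (ltn_ord r)) // frob_eval_pounds -mul_polyC !rmorphM /= mulrA.
  congr (_ * _ * _).
    by rewrite rmorph_int -[RHS]/((@tofrac _ \o polyC) _) rmorph_int.
  by rewrite pFrobenius_autE -exprM mulnC rmorphXn.
(* The modulus is sent to 0, so [L - R] and its remainder have the same image. *)
have := congr1 (frob_eval p_prime) (divp_eq (L - R) M).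
by rewrite evB evL evR scaled_T_sum_power // subrr evD evM frob_eval_modulus mulr0 add0r => <-.
Qed.
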